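(* For all integers $d\geq 1$ and $k\geq 1$, one has the identity of formal power series in $z$ $$\sum_{n=0}^\infty {\lambda_k(n)\choose d}\,z^n=\frac{S_d(k)}{d!}\left(\prod_{j=1}^{\infty}\frac{1}{1-z^j}\right).$$
   Context: A partition of $n$ is a finite decreasing sequence $\lambda=(\lambda_1\geq\dots\geq\lambda_s>0)$ of positive integers (parts) with sum $\vert\lambda\vert=n$; for $k\ge 1$, $\lambda_k$ denotes the $k$-th part, with $\lambda_k=0$ for $k>s$. One also writes a partition as $1^{\nu_1}2^{\nu_2}\cdots$, where $\nu_i$ is the number of parts equal to $i$. The symbol ${\lambda_k(n)\choose d}$ is NOT the binomial coefficient of a single number; it is notation for the sum over all partitions of $n$ $${\lambda_k(n)\choose d}=\sum_{\vert\lambda\vert=n}{\lambda_k\choose d},$$ with ordinary binomial coefficients on the right. For integers $r\geq 1$ and $k\geq 1$ define the formal power series in $z$ $$\sigma_r(k)=\sum_{i=k}^\infty\left(\frac{z^i}{1-z^i}\right)^r,$$ and for $d\geq 1$ define $$S_d(k)=d!\sum_{\vert 1^{\nu_1}2^{\nu_2}\cdots\vert=d}\ \prod_{j=1}^d\frac{(\sigma_j(k))^{\nu_j}}{j^{\nu_j}\,\nu_j!},$$ where the sum is over all partitions $1^{\nu_1}2^{\nu_2}\cdots d^{\nu_d}$ of $d$, i.e. over all tuples of integers $\nu_1,\dots,\nu_d\ge 0$ with $\sum_{j} j\nu_j=d$. *)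

(* Defs.v *)
From HB Require Import structures.
From mathcomp Require Import all_boot all_order all_algebra.
From mathcomp Require Import boolp classical_sets.
Set Implicit Arguments.
Unset Strict Implicit.
Unset Printing Implicit Defensive.
Import GRing.Theory.
Local Open Scope ring_scope.

Definition is_part_of (n : nat) (s : seq nat) : bool :=
  [&& sorted geq s, all (leq 1) s & sumn s == n].

Record intpartn (n : nat) : predArgType :=
  IntPartN {pval :> seq nat; _ : is_part_of n pval}.

HB.instance Definition _ n := [isSub for @pval n].
HB.instance Definition _ n := [Countable of intpartn n by <:].

(* Every partition of n is obtained by deleting the zeros of an n-tuple of
   integers at most n; this only serves to show that there are finitely many. *)
Definition intpartn_cands (n : nat) : seq (seq nat) :=
  [seq [seq x <- map val (t : n.-tuple 'I_n.+1) | (0 < x)%N]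
     | t <- enum {: n.-tuple 'I_n.+1}].

Definition intpartn_enum (n : nat) : seq (intpartn n) :=
  undup (pmap insub (intpartn_cands n)).

Lemma sumn_mem (s : seq nat) x : x \in s -> (x <= sumn s)%N.
Proof.
elim: s => //= y s IHs; rewrite inE => /orP [/eqP -> | /IHs le_x].
  exact: leq_addr.
exact: leq_trans le_x (leq_addl _ _).
Qed.

Lemma size_le_sumn (s : seq nat) : all (leq 1) s -> (size s <= sumn s)%N.
Proof. by elim: s => //= x s IHs /andP [x_gt0 /IHs]; exact: (leq_add x_gt0). Qed.

Lemma mem_intpartn_cands n s : is_part_of n s -> s \in intpartn_cands n.
Proof.
case/and3P => _ s_gt0 /eqP sum_s.
have le_s : (size s <= n)%N by rewrite -sum_s size_le_sumn.
pose p := s ++ nseq (n - size s) 0%N.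
have size_p : size [seq inord x : 'I_n.+1 | x <- p] == n.
  by rewrite size_map size_cat size_nseq subnKC.
apply/mapP; exists (Tuple size_p); first by rewrite mem_enum.
rewrite -map_comp (_ : map _ p = p).
  rewrite filter_cat filter_nseq /= cats0; apply/esym/all_filterP.
  exact: s_gt0.
rewrite -[RHS]map_id; apply/eq_in_map => x x_p /=; apply: inordK.
rewrite ltnS; move: x_p; rewrite mem_cat mem_nseq => /orP [x_s|/andP [_ /eqP ->//]].
by rewrite -sum_s sumn_mem.
Qed.

Lemma intpartn_enum_subproof n : Finite.axiom (intpartn_enum n).
Proof.
apply: Finite.uniq_enumP; first exact: undup_uniq.
case=> s s_n; rewrite mem_undup mem_pmap; apply/mapP.
by exists s; [exact: mem_intpartn_cands | rewrite (insubT (is_part_of n) s_n)].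
Qed.

HB.instance Definition _ n :=
  isFinite.Build (intpartn n) (@intpartn_enum_subproof n).

(* The k-th part, indexed from 1 (only meant for k >= 1); 0 beyond the length. *)
Definition part (l : seq nat) (k : nat) : nat := nth 0%N l k.-1.

Definition multiplicity (l : seq nat) (i : nat) : nat := count_mem i l.

Definition part_binomial (k d n : nat) : nat :=
  \sum_(l : intpartn n) 'C(part l k, d).

(* A wrapper, because functions into a ring may already carry the pointwise
   product. *)
Record fps (R : Type) := FPS {fps_coef :> nat -> R}.

HB.instance Definition _ R := gen_eqMixin (fps R).
HB.instance Definition _ R := gen_choiceMixin (fps R).

Lemma fpsP (R : Type) (f g : fps R) : (forall n, f n = g n) <-> f = g.
Proof.
split=> [|-> //]; case: f => f; case: g => g /= fg.
by congr FPS; apply/funext.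
Qed.

Section FpsZmodule.
Variable V : zmodType.
Implicit Types f g h : fps V.

Definition fps_zero : fps V := FPS (fun=> 0).
Definition fps_opp f : fps V := FPS (fun n => - f n).
Definition fps_add f g : fps V := FPS (fun n => f n + g n).

Lemma fps_addA : associative fps_add.
Proof. by move=> f g h; apply/fpsP => n; exact: addrA. Qed.
Lemma fps_addC : commutative fps_add.
Proof. by move=> f g; apply/fpsP => n; exact: addrC. Qed.
Lemma fps_add0 : left_id fps_zero fps_add.
Proof. by move=> f; apply/fpsP => n; exact: add0r. Qed.
Lemma fps_addN : left_inverse fps_zero fps_opp fps_add.
Proof. by move=> f; apply/fpsP => n; exact: addNr. Qed.

HB.instance Definition _ :=
  GRing.isZmodule.Build (fps V) fps_addA fps_addC fps_add0 fps_addN.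

Lemma fps_coefD f g n : (f + g) n = f n + g n. Proof. by []. Qed.
Lemma fps_coefN f n : (- f) n = - f n. Proof. by []. Qed.
Lemma fps_coef0 n : (0 : fps V) n = 0. Proof. by []. Qed.

End FpsZmodule.

Section FpsRing.
Variable R : comNzRingType.
Implicit Types f g h : fps R.

Definition fps_one : fps R := FPS (fun n => (n == 0%N)%:R).
Definition fps_mul f g : fps R :=
  FPS (fun n => \sum_(i < n.+1) f i * g (n - i)%N).

(* Truncation to a polynomial, to inherit the ring laws from {poly R}. *)
Let trunc n f : {poly R} := \poly_(i < n) f i.

Let coef_trunc n f i : (i < n)%N -> (trunc n f)`_i = f i.
Proof. by move=> lt_in; rewrite coef_poly lt_in. Qed.

Let fps_mul_trunc n f g i :
  (i < n)%N -> fps_mul f g i = (trunc n f * trunc n g)`_i.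
Proof.
move=> lt_in; rewrite coefM; apply: eq_bigr => j _.
rewrite !coef_trunc ?(leq_ltn_trans (leq_subr _ _)) //.
by rewrite (leq_ltn_trans _ lt_in) // -ltnS.
Qed.

Lemma fps_mulA : associative fps_mul.
Proof.
move=> f g h; apply/fpsP => n.
have trM u v i : (i < n.+1)%N ->
    (trunc n.+1 (fps_mul u v))`_i = (trunc n.+1 u * trunc n.+1 v)`_i.
  by move=> lt_in; rewrite coef_trunc // -fps_mul_trunc.
rewrite !(@fps_mul_trunc n.+1) //.
transitivity ((trunc n.+1 f * (trunc n.+1 g * trunc n.+1 h))`_n).
  rewrite ![(trunc _ f * _)`_n]coefM; apply: eq_bigr => i _.
  by rewrite trM ?ltnS ?leq_subr.
rewrite mulrA ![(_ * trunc _ h)`_n]coefM; apply: eq_bigr => i _.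
by rewrite trM.
Qed.

Lemma fps_mulC : commutative fps_mul.
Proof.
by move=> f g; apply/fpsP => n; rewrite !(@fps_mul_trunc n.+1) // mulrC.
Qed.

Lemma fps_mul1 : left_id fps_one fps_mul.
Proof.
move=> f; apply/fpsP => n; rewrite /= big_ord_recl /= mul1r subn0.
by rewrite big1 ?addr0 // => i _; rewrite mul0r.
Qed.

Lemma fps_mulDl : left_distributive fps_mul +%R.
Proof.
move=> f g h; apply/fpsP => n; rewrite /= -big_split /=.
by apply: eq_bigr => i _; rewrite mulrDl.
Qed.

Lemma fps_one_neq0 : fps_one != 0.
Proof. by apply/eqP => /fpsP /(_ 0%N) /eqP; rewrite oner_eq0. Qed.

HB.instance Definition _ :=
  GRing.Zmodule_isComNzRing.Build (fps R)
    fps_mulA fps_mulC fps_mul1 fps_mulDl fps_one_neq0.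

Definition fps_unit : {pred fps R} := fun f => `[< exists g, g * f = 1 >].
Definition fps_inv f : fps R := xget f [set g | g * f = 1]%classic.

Lemma fps_mulVr : {in fps_unit, left_inverse 1 fps_inv *%R}.
Proof. by move=> f /asboolP ex_g; exact: (xgetPex f ex_g). Qed.
Lemma fps_unitPl f g : g * f = 1 -> fps_unit f.
Proof. by move=> gf1; apply/asboolP; exists g. Qed.
Lemma fps_inv_out : {in [predC fps_unit], fps_inv =1 id}.
Proof.
move=> f /asboolP no_inv; apply: xgetPN => g gf1.
by apply: no_inv; exists g.
Qed.

HB.instance Definition _ :=
  GRing.ComNzRing_hasMulInverse.Build (fps R) fps_mulVr fps_unitPl fps_inv_out.

Definition fps_scale (c : R) f : fps R := FPS (fun n => c * f n).

Lemma fps_scaleA a b f : fps_scale a (fps_scale b f) = fps_scale (a * b) f.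
Proof. by apply/fpsP => n; exact: mulrA. Qed.
Lemma fps_scale1 : left_id 1 fps_scale.
Proof. by move=> f; apply/fpsP => n; exact: mul1r. Qed.
Lemma fps_scaleDr : right_distributive fps_scale +%R.
Proof. by move=> c f g; apply/fpsP => n; exact: mulrDr. Qed.
Lemma fps_scaleDl f : {morph fps_scale^~ f : a b / a + b}.
Proof. by move=> a b; apply/fpsP => n; exact: mulrDl. Qed.

HB.instance Definition _ :=
  GRing.Zmodule_isLmodule.Build R (fps R)
    fps_scaleA fps_scale1 fps_scaleDr fps_scaleDl.

Lemma fps_scaleAl (c : R) f g : c *: (f * g) = (c *: f) * g.
Proof.
apply/fpsP => n; rewrite /= mulr_sumr.
by apply: eq_bigr => i _; rewrite mulrA.
Qed.

HB.instance Definition _ := GRing.Lmodule_isLalgebra.Build R (fps R) fps_scaleAl.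
HB.instance Definition _ := GRing.Lalgebra_isComAlgebra.Build R (fps R).

Lemma fps_coef1 n : (1 : fps R) n = (n == 0%N)%:R. Proof. by []. Qed.
Lemma fps_coefM f g n : (f * g) n = \sum_(i < n.+1) f i * g (n - i)%N.
Proof. by []. Qed.
Lemma fps_coefZ c f n : (c *: f) n = c * f n. Proof. by []. Qed.

Definition fpsX : fps R := FPS (fun n => (n == 1%N)%:R).

Lemma fps_coefXM f n : (fpsX * f) n = if n is m.+1 then f m else 0.
Proof.
rewrite fps_coefM; case: n => [|n]; first by rewrite big_ord1 mul0r.
rewrite 2!big_ord_recl /= mul0r add0r mul1r subSS subn0.
by rewrite big1 ?addr0 // => i _; rewrite mul0r.
Qed.

Lemma fps_coefXnM i f n : (fpsX ^+ i * f) n = if (n < i)%N then 0 else f (n - i)%N.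
Proof.
elim: i n => [|i IHi] n; first by rewrite expr0 mul1r subn0.
by rewrite exprS -mulrA fps_coefXM; case: n => [|n] //; rewrite IHi ltnS subSS.
Qed.

Lemma fps_1subXn_unit i : (0 < i)%N -> 1 - fpsX ^+ i \is a GRing.unit.
Proof.
move=> i_gt0; pose g : fps R := FPS (fun n => (i %| n)%:R).
apply: (@fps_unitPl _ g); rewrite mulrBr mulr1 [g * _]mulrC.
apply/fpsP => n; rewrite fps_coefD fps_coefN fps_coefXnM fps_coef1 /=.
case: ltnP => [lt_ni | le_in]; last first.
  rewrite dvdn_subl // subrr; case: eqP => // n0.
  by move: le_in; rewrite n0 leqn0 => /eqP i0; rewrite i0 in i_gt0.
by rewrite subr0; case: n lt_ni => [|n] lt_ni; rewrite ?dvdn0 // gtnNdvd.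
Qed.

(* z-adic convergence; fps_lim is 0 for sequences that do not converge. *)
Definition fps_cvg (u : nat -> fps R) (l : fps R) : Prop :=
  forall n, exists N, forall m, (N <= m)%N -> u m n = l n.

Definition fps_lim (u : nat -> fps R) : fps R :=
  xget 0 [set l | fps_cvg u l]%classic.

Definition fps_sum (k : nat) (f : nat -> fps R) : fps R :=
  fps_lim (fun N => \sum_(k <= i < N) f i).

Definition fps_prod (k : nat) (f : nat -> fps R) : fps R :=
  fps_lim (fun N => \prod_(k <= i < N) f i).

Lemma fps_cvg_unique u l l' : fps_cvg u l -> fps_cvg u l' -> l = l'.
Proof.
move=> ul ul'; apply/fpsP => n; have [N HN] := ul n; have [N' HN'] := ul' n.
by rewrite -(HN (maxn N N')) ?leq_maxl // HN' ?leq_maxr.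
Qed.

Lemma fps_lim_eq u l : fps_cvg u l -> fps_lim u = l.
Proof.
by move=> ul; apply: xget_unique => // l' ul'; exact: fps_cvg_unique ul' ul.
Qed.

Lemma fps_cvg_stable (u : nat -> fps R) (k : nat) :
  (forall n m, (k <= m)%N -> (n < m)%N -> u m.+1 n = u m n) ->
  fps_cvg u (fps_lim u).
Proof.
move=> stab; pose l : fps R := FPS (fun n => u (maxn k n.+1) n).
have ul : fps_cvg u l.
  move=> n; exists (maxn k n.+1) => m /subnKC <-.
  elim: (m - _)%N => [|i IHi]; first by rewrite addn0.
  rewrite addnS stab // (leq_trans _ (leq_addr _ _)) ?leq_maxl ?leq_maxr //.
by rewrite (fps_lim_eq ul).
Qed.

End FpsRing.

Arguments fpsX {R}.

Definition sigma (r k : nat) : fps rat :=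
  fps_sum k (fun i => (fpsX ^+ i / (1 - fpsX ^+ i)) ^+ r).

Definition S_ (d k : nat) : fps rat :=
  (d`!)%:R *: \sum_(l : intpartn d) \prod_(1 <= j < d.+1)
    (((j ^ multiplicity l j * (multiplicity l j)`!)%N%:R : rat)^-1
       *: sigma j k ^+ multiplicity l j).

Definition partition_product : fps rat :=
  fps_prod 1 (fun j => (1 - fpsX ^+ j)^-1).

Lemma sigma_cvg r k : (0 < r)%N ->
  fps_cvg (fun N => \sum_(k <= i < N) (fpsX ^+ i / (1 - fpsX ^+ i)) ^+ r)
          (sigma r k).
Proof.
case: r => // r _; apply: (@fps_cvg_stable _ _ k) => n m le_km lt_nm.
rewrite big_nat_recr // fps_coefD [_ ^+ r.+1]exprS -!mulrA fps_coefXnM lt_nm.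
exact: addr0.
Qed.

Lemma partition_product_cvg :
  fps_cvg (fun N => \prod_(1 <= j < N) (1 - fpsX ^+ j)^-1) partition_product.
Proof.
apply: (@fps_cvg_stable _ _ 1) => n m m_gt0 lt_nm.
rewrite big_nat_recr //; set P := \prod_(_ <= _ < _) _.
have defP : P / (1 - fpsX ^+ m) = P + fpsX ^+ m * (P / (1 - fpsX ^+ m)).
  have U := @fps_1subXn_unit rat m m_gt0.
  apply: (mulIr U); rewrite mulrDl !mulrA !mulrVK //.
  by rewrite mulrBr mulr1 [P * _]mulrC subrK.
rewrite [LHS](congr1 (fun f : fps rat => f n) defP).
by rewrite fps_coefD fps_coefXnM lt_nm addr0.
Qed.

(* Main.v *)
Require Import Defs.
From mathcomp Require Import all_boot all_order all_algebra.
From mathcomp Require Import ring zify.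
From mathcomp Require boolp.
Set Implicit Arguments.
Unset Strict Implicit.
Unset Printing Implicit Defensive.
Import GRing.Theory Num.Theory.
Local Open Scope ring_scope.

(** Write x_i = z^i / (1 - z^i).  The series S_d(k) / d! is the cycle index of
    the symmetric group of degree d in the power sums sigma_j(k) of the
    variables x_k, x_(k+1), ..., that is, the complete homogeneous symmetric
    function h_d of these variables.  Its generating function in t is the
    product over i >= k of
      1 / (1 - t x_i) = (1 - z^i) / (1 - (1 + t) z^i),
    so that multiplying it by the product of all 1 / (1 - z^j) leaves the factors
    1 / (1 - z^i) for i < k and 1 / (1 - (1 + t) z^i) for i >= k.  This is the
    generating function of partitions in which every part >= k has weight 1 + t;
    the coefficient of t^d counts each partition binomial(m, d) times, where m is
    its number of parts >= k.  Conjugation turns m into the k-th part.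

    The proof keeps z as the only formal variable and replaces the series in t by
    recurrences in d.
    - Removing one part j from a partition of d gives the Newton identity
      d h_d = sum_j p_j h_(d-j) for the cycle index ([cycle_index_newton]).  It
      implies the effect of one more variable x, in which all power sums p_j
      grow by x^j: h_d(X, x) = h_d(X) + x h_(d-1)(X, x) ([cycle_index_adjoin]).
    - Removing one part N from a partition with parts at most N, by Pascal's rule,
      gives the matching recurrence for partitions with bounded parts
      ([large_parts_gfS]).  Hence the identity holds for finitely many variables
      ([large_parts_gfE]).
    - Both sides converge z-adically when the bound on the parts grows, and limits
      are unique. *)

(** * Removing a part from a partition *)

Lemma intpartn_sorted n (l : intpartn n) : sorted geq l.
Proof. by case: l => l /= /and3P []. Qed.

Lemma intpartn_gt0 n (l : intpartn n) : all (leq 1) l.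
Proof. by case: l => l /= /and3P []. Qed.

Lemma intpartn_sumn n (l : intpartn n) : sumn l = n.
Proof. by case: l => l /= /and3P [_ _ /eqP]. Qed.

Lemma intpartn_le n (l : intpartn n) i : i \in (l : seq nat) -> (i <= n)%N.
Proof. by move/sumn_mem; rewrite intpartn_sumn. Qed.

Lemma geq_trans : transitive geq.
Proof. by move=> y x z /= le_yx le_zy; exact: leq_trans le_zy le_yx. Qed.

Lemma geq_anti : antisymmetric geq.
Proof. by move=> x y /= xy; apply/eqP; rewrite eqn_leq andbC. Qed.

Lemma geq_total : total geq.
Proof. by move=> x y; exact: leq_total. Qed.

Lemma eq_intpartn_perm n (l m : intpartn n) : perm_eq l m -> l = m.
Proof.
move=> lm; apply: val_inj => /=; apply: (sorted_eq geq_trans geq_anti) => //;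
  exact: intpartn_sorted.
Qed.

Lemma insert_part_subproof n j (l : intpartn (n - j)) :
  (0 < j)%N -> (j <= n)%N -> is_part_of n (sort geq (j :: l)).
Proof.
move=> j_gt0 le_jn; apply/and3P; split; first exact: (sort_sorted geq_total).
  by rewrite all_sort /= j_gt0 intpartn_gt0.
by rewrite (perm_sumn (permEl (perm_sort _ _))) /= intpartn_sumn subnKC.
Qed.

Lemma remove_part_subproof n j (l : intpartn n) :
  j \in (l : seq nat) -> is_part_of (n - j) (rem j l).
Proof.
move=> j_l; apply/and3P; split.
- exact: (subseq_sorted geq_trans (rem_subseq _ _) (intpartn_sorted l)).
- by apply/allP => i /mem_rem; apply/allP: i; exact: intpartn_gt0.
- by rewrite -[X in (X - _)%N](intpartn_sumn l) (perm_sumn (perm_to_rem j_l)) /= addKn.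
Qed.

(** Deleting one copy of j, or inserting one, is a bijection between the partitions
    of n that have a part j and the partitions of n - j.  Since f is insensitive to
    the order of the parts, j can be put in front instead of in its sorted place.
    Both the Newton identity and the recurrence on the largest part come from this
    bijection. *)
Lemma sum_intpartn_mem (V : nmodType) n j (f : seq nat -> V) :
    (0 < j)%N -> (forall s t, perm_eq s t -> f s = f t) ->
  \sum_(l : intpartn n | j \in (l : seq nat)) f l
    = if (j <= n)%N then \sum_(l : intpartn (n - j)) f (j :: l) else 0.
Proof.
move=> j_gt0 f_perm; case: ifPn => [le_jn | lt_nj]; last first.
  by rewrite big1 // => l /intpartn_le le_jn; rewrite le_jn in lt_nj.
pose ins l := IntPartN (insert_part_subproof l j_gt0 le_jn).
have ins_perm l : perm_eq (ins l) (j :: l) by exact: (permEl (perm_sort _ _)).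
rewrite (reindex_omap ins (fun l : intpartn n => insub (rem j l))) /=; last first.
  move=> l j_l; rewrite (insubT _ (remove_part_subproof j_l)) /=.
  congr Some; apply: eq_intpartn_perm; apply: perm_trans (ins_perm _) _.
  by rewrite perm_sym perm_to_rem.
apply: eq_big => [l | l _]; last exact/f_perm/ins_perm.
have j_ins : j \in (ins l : seq nat) by rewrite (perm_mem (ins_perm l)) mem_head.
rewrite j_ins (insubT _ (remove_part_subproof j_ins)) /=.
apply/eqP; congr Some; apply: eq_intpartn_perm => /=.
rewrite -(perm_cons j); apply: perm_trans (ins_perm l).
by rewrite perm_sym perm_to_rem.
Qed.

Lemma sumn_multiplicity n (l : intpartn n) :
  n = (\sum_(i < n) i.+1 * multiplicity l i.+1)%N.
Proof.
rewrite -{1}(intpartn_sumn l) sumnE.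
transitivity (\sum_(i <- l) \sum_(j < n) j.+1 * (i == j.+1))%N; last first.
  rewrite exchange_big; apply: eq_bigr => j _ /=.
  by rewrite -big_distrr /= /multiplicity -sum1_count [in RHS]big_mkcond.
rewrite [RHS]big_seq [LHS]big_seq; apply: eq_bigr => i i_l.
have /allP /(_ i i_l) := intpartn_gt0 l; have := intpartn_le i_l.
case: i {i_l} => // i lt_in _.
rewrite (bigD1 (Ordinal lt_in)) //= eqxx muln1 big1 ?addn0 // => j ne_ji.
rewrite eqSS (_ : (i == j) = false) ?muln0 //.
by apply/eqP => eq_ij; move/eqP: ne_ji; case; apply: val_inj; rewrite /= eq_ij.
Qed.

(** * The cycle index of the symmetric group *)

Section CycleIndex.
Variable A : comAlgType rat.
Implicit Types (p q : nat -> A) (s t : seq nat) (x : A) (d : nat).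

(** The bound B on the parts is independent of the sum of s, so that the weights of
    a partition before and after the removal of a part can be compared. *)
Definition cycle_weight p B s : A :=
  \prod_(1 <= j < B) (((j ^ multiplicity s j * (multiplicity s j)`!)%N%:R : rat)^-1
       *: p j ^+ multiplicity s j).

Definition cycle_index p d : A := \sum_(l : intpartn d) cycle_weight p d.+1 l.

Lemma cycle_weight_perm p B s t :
  perm_eq s t -> cycle_weight p B s = cycle_weight p B t.
Proof.
by move/permP=> st; apply: eq_bigr => j _; rewrite /multiplicity st.
Qed.

Lemma cycle_weight_widen p B C s : (0 < B <= C)%N -> (forall i, i \in s -> i < B)%N ->
  cycle_weight p C s = cycle_weight p B s.
Proof.
case/andP=> B_gt0 le_BC s_lt; rewrite /cycle_weight (big_cat_nat B_gt0 le_BC) /=.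
rewrite -[RHS]mulr1; congr (_ * _); rewrite big_nat_cond.
rewrite big1 // => j; rewrite andbT => /andP [le_Bj _].
have j_s : j \notin s by apply/negP => /s_lt; rewrite ltnNge le_Bj.
by rewrite /multiplicity (count_memPn j_s) expr0 expn0 mul1n fact0 invr1 scale1r.
Qed.

(** With m the multiplicity of j in s, adding a part j replaces the factor
    p_j^m / (j^m m!) by p_j^(m+1) / (j^(m+1) (m+1)!). *)
Lemma cycle_weight_cons p B j s : (0 < j < B)%N ->
  ((j * (multiplicity s j).+1)%N%:R : rat) *: cycle_weight p B (j :: s)
     = p j * cycle_weight p B s.
Proof.
move=> j_B; have j_iota : j \in index_iota 1 B by rewrite mem_index_iota.
rewrite /cycle_weight !(big_rem j j_iota) /= -scalerAl scalerA [LHS]scalerAl mulrA.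
congr (_ * _); last first.
  rewrite big_seq [RHS]big_seq; apply: eq_bigr => i.
  rewrite (mem_rem_uniq _ (iota_uniq _ _)) !inE => /andP [ne_ij _].
  by rewrite /multiplicity /= eq_sym (negPf ne_ij).
rewrite -scalerAr /multiplicity /= eqxx add1n -exprS.
congr (_ *: _).
rewrite factS expnS; set m := count_mem j s.
rewrite mulnACA [X in _ / X]natrM invfM mulrA mulfV ?mul1r // pnatr_eq0 muln_eq0 negb_or.
by case/andP: j_B => j_gt0 _; rewrite -lt0n j_gt0.
Qed.

(** Newton's identity.  Write d as the sum over j of j times the multiplicity of j in
    a partition of d; for fixed j only the partitions with a part j contribute, and
    by [cycle_weight_cons] the factor j * multiplicity is absorbed when one
    such part is removed. *)
Lemma cycle_index_newton p d :
  (d%:R : rat) *: cycle_index p d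
    = \sum_(i < d) p i.+1 * cycle_index p (d - i.+1).
Proof.
pose F j s := (j * multiplicity s j)%N%:R *: cycle_weight p d.+1 s.
transitivity (\sum_(l : intpartn d) \sum_(i < d) F i.+1 l).
  rewrite scaler_sumr; apply: eq_bigr => l _.
  by rewrite -scaler_suml -natr_sum -sumn_multiplicity.
rewrite exchange_big; apply: eq_bigr => i _ /=.
transitivity (\sum_(l : intpartn d | i.+1 \in (l : seq nat)) F i.+1 l).
  rewrite [RHS]big_mkcond; apply: eq_bigr => l _; case: ifPn => // /count_memPn.
  by rewrite /F /multiplicity => ->; rewrite muln0 scale0r.
rewrite sum_intpartn_mem // => [|s t st]; last first.
  by rewrite /F (cycle_weight_perm _ _ st) /multiplicity (permP st).
rewrite ltn_ord mulr_sumr; apply: eq_bigr => l _.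
rewrite /F /multiplicity /= eqxx add1n cycle_weight_cons ?ltnS ?ltn_ord //.
congr (_ * _); apply: cycle_weight_widen => [|j /intpartn_le]; last by rewrite ltnS.
by rewrite /= ltnS leq_subr.
Qed.

Lemma cycle_index0 p : cycle_index p 0 = 1.
Proof.
have part0 (l : intpartn 0) : (l : seq nat) = [::].
  apply: size0nil; apply/eqP; rewrite -leqn0.
  by rewrite (leq_trans (size_le_sumn (intpartn_gt0 l))) ?intpartn_sumn.
have p0 : is_part_of 0 [::] by [].
rewrite /cycle_index (big_pred1 (IntPartN p0)).
  by rewrite /cycle_weight big_geq.
by move=> l; apply/esym/eqP/val_inj; rewrite /= part0.
Qed.

Lemma scaler_natI d : injective (fun x : A => (d.+1%:R : rat) *: x).
Proof. by apply: scalerI; rewrite pnatr_eq0. Qed.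

Lemma cycle_index_eq0 p d : (forall j, p j = 0) -> (0 < d)%N -> cycle_index p d = 0.
Proof.
case: d => // d p0 _; apply: (@scaler_natI d); rewrite cycle_index_newton scaler0.
by rewrite big1 // => i _; rewrite p0 mul0r.
Qed.

(** The recurrence h_d(X, x) = h_d(X) + x h_(d-1)(X, x) for one more variable x,
    where p and q stand for the power sums without and with x.  It follows
    by induction on d from Newton's identity, which holds for any sequence p. *)
Lemma cycle_index_adjoin p q x d : (forall j, q j = p j + x ^+ j) ->
  cycle_index q d.+1 = cycle_index p d.+1 + x * cycle_index q d.
Proof.
move=> def_q; have [m] := ubnP d; elim: m d => // m IHm d /ltnSE le_dm.
apply: (@scaler_natI d); rewrite scalerDr !cycle_index_newton.
(* The induction hypothesis applies to all terms but the last, where both cycle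
   indices are 1. *)
have split_p : \sum_(i < d.+1) p i.+1 * cycle_index q (d.+1 - i.+1)
    = \sum_(i < d.+1) p i.+1 * cycle_index p (d.+1 - i.+1)
      + x * \sum_(i < d) p i.+1 * cycle_index q (d - i.+1).
  rewrite !big_ord_recr /= !subnn !cycle_index0 mulr_sumr addrAC.
  congr (_ + _); rewrite -big_split; apply: eq_bigr => i _ /=.
  rewrite (subSn (ltn_ord i)) IHm; last by have := ltn_ord i; lia.
  by rewrite mulrDr mulrCA.
under eq_bigr do rewrite def_q mulrDl.
rewrite big_split /= split_p -addrA; congr (_ + _).
(* What is left is x h_d plus x times the Newton sum for d h_d. *)
rewrite big_ord_recl subSS subn0 expr1.
under [X in _ + (_ + X)]eq_bigr do rewrite exprS -mulrA.
rewrite -mulr_sumr addrCA -mulrDr -big_split /=.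
under eq_bigr do rewrite -mulrDl -def_q.
by rewrite -cycle_index_newton -mulrDr [RHS]scalerAr -natr1 scalerDl scale1r addrC.
Qed.

End CycleIndex.

(** * Conjugate partitions *)

(** The columns of the Young diagram: column i has one cell for each part > i, and
    there are as many columns as the first part says. *)
Definition conjugate (s : seq nat) : seq nat :=
  [seq count (leq i.+1) s | i <- iota 0 (head 0%N s)].

(** Both sides vanish for i beyond the first part. *)
Lemma nth_conjugate s i : sorted geq s ->
  nth 0%N (conjugate s) i = count (leq i.+1) s.
Proof.
move=> s_sorted; case: (ltnP i (head 0%N s)) => [lt_i | le_i].
  by rewrite (nth_map 0%N) ?size_iota // nth_iota.
rewrite nth_default ?size_map ?size_iota //; apply/esym/eqP.
rewrite -leqn0 leqNgt -has_count; apply/hasPn => x.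
case: s s_sorted le_i => //= y s /(order_path_min geq_trans) /allP le_y le_yi.
rewrite inE -leqNgt => /orP [/eqP -> // | /le_y /= le_xy].
exact: leq_trans le_xy le_yi.
Qed.

Lemma conjugate_subproof n (l : intpartn n) : is_part_of n (conjugate l).
Proof.
have sl := intpartn_sorted l; apply/and3P; split.
- apply: (homo_sorted (e := leq)); last exact: iota_sorted.
  by move=> i j le_ij; apply: sub_count => x /(leq_ltn_trans le_ij).
- rewrite all_map; apply/allP => i; rewrite mem_iota add0n /= -has_count.
  case: (l : seq nat) => //= x s lt_ix; exact/orP/or_introl.
(* Count the cells by columns and by rows. *)
- have le_head x : x \in (l : seq nat) -> (x <= head 0 l)%N.
    case: (l : seq nat) sl => //= y s /(order_path_min geq_trans) /allP le_y.
    by rewrite inE => /orP [/eqP -> // | /le_y].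
  rewrite sumnE big_map -[X in _ == X](intpartn_sumn l) sumnE.
  under eq_bigr do rewrite -sum1_count big_mkcond.
  rewrite exchange_big big_seq [X in _ == X]big_seq; apply/eqP.
  apply: eq_bigr => x /le_head le_x.
  rewrite -(subnKC le_x) iotaD big_cat -!big_mkcond !sum1_count /=.
  rewrite (eq_in_count (a2 := predT)) => [|i]; last by rewrite mem_iota.
  rewrite count_predT size_iota (eq_in_count (a2 := pred0)) ?count_pred0 ?addn0 //.
  by move=> i; rewrite mem_iota /= => /andP [le_xi _]; rewrite ltnNge le_xi.
Qed.

Definition conj_part n (l : intpartn n) : intpartn n :=
  IntPartN (conjugate_subproof l).

(** The conjugate determines the number of parts >= i for each i > 0, hence all
    multiplicities.  On a finite type, injectivity is all that reindexing needs. *)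
Lemma conj_part_inj n : injective (@conj_part n).
Proof.
move=> l m lm; apply: eq_intpartn_perm; apply/allP => x _ /=; apply/eqP.
have cnt_lm i : count (leq i.+1) l = count (leq i.+1) m.
  have := congr1 (fun t : intpartn n => nth 0%N t i) lm.
  by rewrite /= !nth_conjugate ?intpartn_sorted.
have cnt_x (t : seq nat) i : count (leq i.+1) t = (count_mem i.+1 t + count (leq i.+2) t)%N.
  elim: t => //= y t ->; rewrite leq_eqVlt eq_sym.
  by case: (ltngtP y i.+1) => /=; lia.
have no0 (t : intpartn n) : count_mem 0%N t = 0%N.
  by apply/count_memPn/negP => /(allP (intpartn_gt0 t)).
case: x => [|x]; first by rewrite !no0.
by have := cnt_lm x; rewrite (cnt_x l) (cnt_x m) cnt_lm => /addIn.
Qed.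

Lemma part_binomial_conj k d n : (0 < k)%N ->
  part_binomial k d n = (\sum_(l : intpartn n) 'C(count (leq k) l, d))%N.
Proof.
move=> k_gt0; rewrite /part_binomial (reindex_inj (@conj_part_inj n)).
by apply: eq_bigr => l _; rewrite /part nth_conjugate ?intpartn_sorted ?prednK.
Qed.

(** * Partitions with bounded parts *)

(** The coefficient of t^d in the generating function of the partitions with all
    parts < N, where each part >= k has weight 1 + t. *)
Definition large_parts_gf k N d : fps rat :=
  FPS (fun n => (\sum_(l : intpartn n | all (ltn^~ N) l) 'C(count (leq k) l, d))%N%:R).

Lemma large_parts_gf1 k d : large_parts_gf k 1 d = (d == 0%N)%:R.
Proof.
have nil_of n (l : intpartn n) : all (ltn^~ 1%N) l -> (l : seq nat) = [::].
  case: (l : seq nat) (intpartn_gt0 l) => //= x s /andP [x_gt0 _] /andP [x_lt1 _].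
  by move: x_lt1; rewrite ltnNge x_gt0.
apply/fpsP => n; rewrite -[RHS]/(((d == 0%N)%:R : fps rat) n) -[_%:R in RHS]scaler_nat.
rewrite fps_coefZ fps_coef1 -natrM /=; congr (_%:R).
case: n => [|n] /=; last first.
  rewrite muln0 big_pred0 // => l; apply/negP => /nil_of l0.
  by have := intpartn_sumn l; rewrite l0.
have p0 : is_part_of 0 [::] by [].
rewrite (big_pred1 (IntPartN p0)) /= => [|l]; first by rewrite muln1 bin0n.
apply/idP/eqP => [/nil_of l0 | -> //]; exact: val_inj.
Qed.

(** A partition with parts at most N either has all its parts < N or has a part N,
    which is removed.  If N >= k the removal lowers the number of parts >= k by
    one, and Pascal's rule splits the binomial coefficient in two.  For d = 0
    there is no second term, hence the conditional. *)
Lemma large_parts_gfS k N d : (0 < N)%N ->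
  large_parts_gf k N.+1 d = large_parts_gf k N d
    + fpsX ^+ N * (large_parts_gf k N.+1 d
        + (if (k <= N)%N && (0 < d)%N then large_parts_gf k N.+1 d.-1 else 0)).
Proof.
move=> N_gt0; apply/fpsP => n; rewrite fps_coefD fps_coefXnM.
pose F s := if all (ltn^~ N.+1) s then 'C(count (leq k) s, d) else 0%N.
have F_perm s t : perm_eq s t -> F s = F t.
  by move=> st; rewrite /F (perm_all _ st) (permP st).
transitivity ((\sum_(l : intpartn n | all (ltn^~ N) l) 'C(count (leq k) l, d)
    + \sum_(l : intpartn n | N \in (l : seq nat)) F l)%N%:R : rat).
  rewrite /= (bigID (fun l : intpartn n => N \in (l : seq nat))) /= addnC.
  congr ((_ + _)%N%:R); last by rewrite big_mkcondl.
  apply: eq_bigl => l; rewrite -has_pred1 -all_predC -all_predI.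
  by apply: eq_all => x /=; rewrite ltnS [(x <= N)%N]leq_eqVlt; case: ltngtP.
rewrite natrD sum_intpartn_mem // ltnNge; congr (_ + _).
case: (N <= n)%N => //; rewrite [~~ _]/= fps_coefD.
rewrite (_ : fps_coef (if _ then _ else _) (n - N)%N
  = (\sum_(l : intpartn (n - N) | all (ltn^~ N.+1) l)
      if (k <= N)%N && (0 < d)%N then 'C(count (leq k) l, d.-1) else 0)%N%:R); last first.
  by case: ifP => //; rewrite big1.
rewrite -natrD -big_split [in RHS]big_mkcond; congr (_%:R); apply: eq_bigr => l _.
rewrite /F /= ltnSn /=; case: ifP => // _.
case: (k <= N)%N => /=; last by rewrite addn0.
by case: (d) => [|e] /=; rewrite ?bin0 // binS.
Qed.

(** The variable x_i = z^i + z^(2i) + ... of the symmetric functions. *)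
Definition geom i : fps rat := fpsX ^+ i / (1 - fpsX ^+ i).

(** The identity of the theorem for finitely many variables.  Multiplied by
    1 - z^N, both sides obey the same recurrence when N is allowed as a new part:
    on the right this is [cycle_index_adjoin] with x = z^N / (1 - z^N) if N >= k,
    and only the product changes if N < k. *)
Lemma large_parts_gfE k N d : (0 < k)%N ->
  large_parts_gf k N.+1 d
    = cycle_index (fun j => \sum_(k <= i < N.+1) geom i ^+ j) d
      * \prod_(1 <= i < N.+1) (1 - fpsX ^+ i)^-1.
Proof.
move=> k_gt0; elim: N d => [|N IHN] d.
  rewrite large_parts_gf1 big_geq // mulr1; case: d => [|d].
    by rewrite cycle_index0.
  by rewrite cycle_index_eq0 // => j; rewrite big_geq.
set p := fun j => \sum_(k <= i < N.+2) _; set P := \prod_(_ <= _ < _) _.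
have U := fps_1subXn_unit rat (ltn0Sn N).
pose P0 : fps rat := \prod_(1 <= i < N.+1) (1 - fpsX ^+ i)^-1.
have defP : P = P0 / (1 - fpsX ^+ N.+1) by rewrite /P big_nat_recr.
have solve (f g h : fps rat) : f = g + fpsX ^+ N.+1 * (f + h) ->
    f = (g + fpsX ^+ N.+1 * h) / (1 - fpsX ^+ N.+1).
  move=> eq_f; apply: (mulIr U); rewrite mulrVK //.
  by rewrite mulrBr mulr1 {1}eq_f; ring.
case: (leqP k N.+1) => [le_kN | lt_Nk]; last first.
  rewrite (solve _ _ _ (large_parts_gfS k d (ltn0Sn N))) leqNgt lt_Nk /=.
  rewrite mulr0 addr0 IHN defP [RHS]mulrA -/P0.
  have -> // : p = (fun j => \sum_(k <= i < N.+1) geom i ^+ j).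
  by apply/boolp.funext => j; rewrite /p !big_geq // ltnW.
elim: d => [|d IHd]; rewrite (solve _ _ _ (large_parts_gfS k _ (ltn0Sn N))) le_kN /=.
  by rewrite mulr0 addr0 IHN !cycle_index0 !mul1r -defP.
have adj : cycle_index p d.+1
  = cycle_index (fun j => \sum_(k <= i < N.+1) geom i ^+ j) d.+1
    + geom N.+1 * cycle_index p d.
  by apply: cycle_index_adjoin => j; rewrite /p big_nat_recr.
by rewrite IHd IHN adj defP /geom -/P0; ring.
Qed.

(** * Passage to the limit *)

Section Cvg.
Variable R : comNzRingType.
Implicit Types (u v : nat -> fps R) (f g : fps R).

Lemma fps_cvg_cst f : fps_cvg (fun=> f) f.
Proof. by move=> n; exists 0%N. Qed.

Lemma fps_cvgD u v f g : fps_cvg u f -> fps_cvg v g ->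
  fps_cvg (fun N => u N + v N) (f + g).
Proof.
move=> uf vg n; have [M uM] := uf n; have [M' vM'] := vg n.
exists (maxn M M') => m; rewrite geq_max => /andP [le_M le_M'].
by rewrite !fps_coefD uM ?vM'.
Qed.

Lemma fps_cvgZ c u f : fps_cvg u f -> fps_cvg (fun N => c *: u N) (c *: f).
Proof.
by move=> uf n; have [M uM] := uf n; exists M => m le_M; rewrite !fps_coefZ uM.
Qed.

Lemma fps_cvg_below u f n : fps_cvg u f ->
  exists M, forall m i, (M <= m)%N -> (i <= n)%N -> u m i = f i.
Proof.
move=> uf; elim: n => [|n [M uM]].
  by have [M uM] := uf 0%N; exists M => m i le_M; rewrite leqn0 => /eqP ->; exact: uM.
have [M' uM'] := uf n.+1; exists (maxn M M') => m i; rewrite geq_max.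
case/andP=> le_M le_M'; rewrite leq_eqVlt => /orP [/eqP -> | ]; [exact: uM' | exact: uM].
Qed.

Lemma fps_cvgM u v f g : fps_cvg u f -> fps_cvg v g ->
  fps_cvg (fun N => u N * v N) (f * g).
Proof.
move=> uf vg n; have [M uM] := fps_cvg_below n uf.
have [M' vM'] := fps_cvg_below n vg.
exists (maxn M M') => m; rewrite geq_max => /andP [le_M le_M'].
rewrite !fps_coefM; apply: eq_bigr => i _.
by rewrite uM ?vM' ?leq_subr // -ltnS.
Qed.

Lemma fps_cvgX e u f : fps_cvg u f -> fps_cvg (fun N => u N ^+ e) (f ^+ e).
Proof.
move=> uf; elim: e => [|e IHe]; first exact: fps_cvg_cst.
rewrite exprS; under boolp.eq_fun do rewrite exprS.
exact: fps_cvgM.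
Qed.

Lemma fps_cvg_sum (I : Type) (r : seq I) (u : I -> nat -> fps R) (f : I -> fps R) :
    (forall i, fps_cvg (u i) (f i)) ->
  fps_cvg (fun N => \sum_(i <- r) u i N) (\sum_(i <- r) f i).
Proof.
move=> uf; elim: r => [|i r IHr].
  by rewrite big_nil; under boolp.eq_fun do rewrite big_nil; exact: fps_cvg_cst.
rewrite big_cons; under boolp.eq_fun do rewrite big_cons.
exact: fps_cvgD.
Qed.

Lemma fps_cvg_prod (I : eqType) (r : seq I) (u : I -> nat -> fps R) (f : I -> fps R) :
    (forall i, i \in r -> fps_cvg (u i) (f i)) ->
  fps_cvg (fun N => \prod_(i <- r) u i N) (\prod_(i <- r) f i).
Proof.
elim: r => [|i r IHr] uf.
  by rewrite big_nil; under boolp.eq_fun do rewrite big_nil; exact: fps_cvg_cst.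
rewrite big_cons; under boolp.eq_fun do rewrite big_cons.
apply: fps_cvgM; first by apply: uf; rewrite mem_head.
by apply: IHr => j j_r; apply: uf; rewrite inE j_r orbT.
Qed.

End Cvg.

(** The power sum of index 0 does not occur in the cycle index, so convergence is
    required for j > 0 only; for j = 0 the sums defining sigma diverge. *)
Lemma cycle_index_cvg (p : nat -> nat -> fps rat) (q : nat -> fps rat) d :
    (forall j, (0 < j)%N -> fps_cvg (p j) (q j)) ->
  fps_cvg (fun N => cycle_index (p^~ N) d) (cycle_index q d).
Proof.
move=> pq; apply: fps_cvg_sum => l; apply: fps_cvg_prod => j.
rewrite mem_index_iota => /andP [j_gt0 _].
exact/fps_cvgZ/fps_cvgX/pq.
Qed.

Lemma large_parts_gf_cvg k d : (0 < k)%N ->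
  fps_cvg (fun N => large_parts_gf k N d) (FPS (fun n => (part_binomial k d n)%:R)).
Proof.
move=> k_gt0 n; exists n.+1 => N lt_nN /=; rewrite part_binomial_conj //.
congr (_%:R); apply: eq_bigl => l; apply/allP => i /intpartn_le le_in.
exact: leq_ltn_trans lt_nN.
Qed.

Theorem theorem1p7 (d k : nat) (hd : (1 <= d)%N) (hk : (1 <= k)%N) :
  FPS (fun n => (part_binomial k d n)%:R : rat)
    = ((d`!)%:R^-1 *: S_ d k) * partition_product.
Proof.
rewrite /S_ scalerA mulVf ?scale1r ?pnatr_eq0 -?lt0n ?fact_gt0 //.
apply: fps_cvg_unique (large_parts_gf_cvg d hk) _ => n.
have [M HM] := fps_cvgM
  (cycle_index_cvg d (fun j j_gt0 => @sigma_cvg j k j_gt0))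
  partition_product_cvg n.
(* The bound on the parts must be a successor in [large_parts_gfE]. *)
exists (maxn M 1) => -[|N]; rewrite geq_max => /andP [le_MN //] _.
by rewrite large_parts_gfE // [LHS]HM.
Qed.
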